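(* Let $p\in(1,\infty)$ and let $Y$ be a quasi-reflexive $p$-AUS Banach space. Then there exists a constant $C>0$ such that for every $k\in\mathbb N$, every infinite subset $\mathbb M$ of $\mathbb N$, every Lipschitz map $f:(G_k(\mathbb M),d)\to Y^{**}$ and every $\varepsilon>0$, there exists an infinite subset $\mathbb M'$ of $\mathbb M$ such that $$\forall (\overline n,\overline m)\in I_k(\mathbb M'),\qquad \|f(\overline n)-f(\overline m)\|\le C\,\mathrm{Lip}(f)\,k^{1/p}+\varepsilon.$$
   Context: A Banach space $Y$ is quasi-reflexive if the image of its canonical embedding into $Y^{**}$ has finite codimension in $Y^{**}$. For a Banach space $X$ with unit sphere $S_X$, $t\in[0,\infty)$, $x\in S_X$ and $Z$ a closed linear subspace of $X$, put $\overline{\rho}_X(t,x,Z)=\sup_{z\in S_Z}(\|x+tz\|-1)$ (with value $0$ if $Z=\{0\}$), $\overline{\rho}_X(t,x)=\inf_{\dim(X/Z)<\infty}\overline{\rho}_X(t,x,Z)$ and $\overline{\rho}_X(t)=\sup_{x\in S_X}\overline{\rho}_X(t,x)$. For $p\in(1,\infty)$, $X$ is $p$-AUS if there exists $c>0$ such that $\overline{\rho}_X(t)\le ct^p$ for all $t\in[0,\infty)$. For an infinite subset $\mathbb M$ of $\mathbb N$ and $k\in\mathbb N$, $G_k(\mathbb M)=\{\overline n=(n_1,\dots,n_k):\ n_i\in\mathbb M,\ n_1<\dots<n_k\}$, equipped with the distance $d(\overline n,\overline m)=|\{j:\ n_j\ne m_j\}|$. The set of strictly interlaced pairs is $I_k(\mathbb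 M)=\{(\overline n,\overline m)\in G_k(\mathbb M)\times G_k(\mathbb M):\ n_1<m_1<n_2<m_2<\dots<n_k<m_k\}$. $\mathrm{Lip}(f)$ denotes the best Lipschitz constant of $f$. *)

(* Defs.v *)
From HB Require Import structures.
From mathcomp Require Import all_boot all_order all_algebra.
From mathcomp Require Import all_classical all_reals all_analysis.

Set Implicit Arguments.
Unset Strict Implicit.
Unset Printing Implicit Defensive.
Import Order.TTheory GRing.Theory Num.Theory.
Import numFieldNormedType.Exports.
Local Open Scope classical_set_scope.
Local Open Scope ring_scope.

(* The topological dual: continuous linear forms on X with the operator norm.
   It is made a normedModType, so that the bidual of X is dual (dual X). *)
Section Dual.
Context {R : realType} (X : normedModType R).

Definition cont_lin : {pred X -> R^o} :=
  [pred f | `[< linear (f : X -> R^o) /\ continuous (f : X -> R^o) >]].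

Lemma cont_lin_submod_closed : submod_closed cont_lin.
Proof.
split.
  apply/asboolP; split; last by move=> x; exact: cvg_cst.
  by move=> a x y /=; rewrite scaler0 addr0.
move=> a f g /asboolP[lf cf] /asboolP[lg cg]; apply/asboolP; split.
  move=> b x y.
  change (a *: f (b *: x + y) + g (b *: x + y) =
          b *: (a *: f x + g x) + (a *: f y + g y)).
  rewrite lf lg !scalerDr !scalerA [b * a]mulrC -!addrA; congr (_ + _).
  by rewrite addrCA.
move=> x; change ((fun y => a *: f y + g y) @ x --> a *: f x + g x).
by apply: cvgD; [apply: cvgZr; exact: cf|exact: cg].
Qed.

HB.instance Definition _ :=
  GRing.isSubmodClosed.Build R (X -> R^o) cont_lin cont_lin_submod_closed.

Record dual := Dual { dual_fun :> X -> R^o; dual_funP : dual_fun \in cont_lin }.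

HB.instance Definition _ := [isSub for dual_fun].
HB.instance Definition _ := [Choice of dual by <:].
HB.instance Definition _ := [SubChoice_isSubLmodule of dual by <:].

Definition dual_norm (f : dual) : R :=
  sup [set `|f x| | x in [set x : X | `|x| <= 1]].

Lemma dual_linear (f : dual) : linear (f : X -> R^o).
Proof. by case: f => f /= /asboolP[]. Qed.

Lemma dual_continuous (f : dual) : continuous (f : X -> R^o).
Proof. by case: f => f /= /asboolP[]. Qed.

Lemma dual_addE (f g : dual) x : (f + g) x = f x + g x.
Proof. by []. Qed.

Lemma dual_scaleE a (f : dual) x : (a *: f) x = a * f x.
Proof. by []. Qed.

Lemma dual0 (f : dual) : f 0 = 0.
Proof. by have := dual_linear f (-1) 0 0; rewrite scaler0 addr0 scaleN1r addNr. Qed.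

Lemma dualZ (f : dual) a x : f (a *: x) = a * f x.
Proof. by have := dual_linear f a x 0; rewrite !addr0 dual0 addr0. Qed.

Lemma dual_bounded (f : dual) :
  exists2 M, 0 < M & forall x : X, `|f x| <= M * `|x|.
Proof.
pose lf := GRing.isLinear.Build R X R^o *:%R f (dual_linear f).
pose F : {linear X -> R^o} := HB.pack (f : X -> R^o) lf.
have /linear_boundedP/pinfty_ex_gt0[M M0 HM] : bounded_near F (nbhs (0 : X)).
  by apply: (continuous_linear_bounded 0); exact: (@dual_continuous f 0).
by exists M.
Qed.

Lemma dual_norm_has_sup (f : dual) :
  has_sup [set `|f x| | x in [set x : X | `|x| <= 1]].
Proof.
split; first by exists `|f 0|; exists 0 => //=; rewrite normr0.
have [M M0 HM] := dual_bounded f; exists M => _ [x /= x1 <-].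
by rewrite (le_trans (HM x))// -[leRHS]mulr1 ler_wpM2l// ltW.
Qed.

Lemma dual_norm_ub (f : dual) x : `|x| <= 1 -> `|f x| <= dual_norm f.
Proof. by move=> x1; apply: sup_upper_bound (dual_norm_has_sup f) _ _; exists x. Qed.

Lemma dual_norm_le (f : dual) c :
  (forall x, `|x| <= 1 -> `|f x| <= c) -> dual_norm f <= c.
Proof.
move=> H; apply: ge_sup; first exact: (dual_norm_has_sup f).1.
by move=> _ [x /= x1 <-]; exact: H.
Qed.

Lemma dual_norm_ge0 (f : dual) : 0 <= dual_norm f.
Proof. by rewrite (le_trans (normr_ge0 (f 0)))// dual_norm_ub// normr0. Qed.

Lemma dual_normP (f : dual) x : `|f x| <= dual_norm f * `|x|.
Proof.
have [->|x0] := eqVneq x 0; first by rewrite dual0 !normr0 mulr0.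
have nx0 : 0 < `|x| by rewrite normr_gt0.
rewrite -ler_pdivrMr// mulrC.
have -> : `|x|^-1 * `|f x| = `|f (`|x|^-1 *: x)|.
  by rewrite dualZ normrM gtr0_norm// invr_gt0.
by apply: dual_norm_ub; rewrite normrZ gtr0_norm ?invr_gt0// mulVf ?gt_eqF.
Qed.

Lemma dual_norm_triangle (f g : dual) :
  dual_norm (f + g) <= dual_norm f + dual_norm g.
Proof.
apply: dual_norm_le => x x1; rewrite dual_addE.
by rewrite (le_trans (ler_normD _ _))// lerD// dual_norm_ub.
Qed.

Lemma dual_normZ a (f : dual) : dual_norm (a *: f) = `|a| * dual_norm f.
Proof.
have Hle b (g : dual) : dual_norm (b *: g) <= `|b| * dual_norm g.
  apply: dual_norm_le => x x1; rewrite dual_scaleE normrM.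
  by rewrite ler_wpM2l// dual_norm_ub.
apply/eqP; rewrite eq_le Hle/=; have [->|a0] := eqVneq a 0.
  by rewrite normr0 mul0r dual_norm_ge0.
rewrite -ler_pdivlMl ?normr_gt0// -normfV (le_trans _ (Hle _ _))//.
by rewrite scalerA mulVf// scale1r.
Qed.

Lemma dual_norm0_eq0 (f : dual) : dual_norm f = 0 -> f = 0.
Proof.
move=> f0; apply/val_inj/funext => x /=; apply/eqP; rewrite -normr_le0.
by rewrite (le_trans (dual_normP f x))// f0 mul0r.
Qed.

HB.instance Definition _ := Lmodule_isNormed.Build R dual
  dual_norm_triangle dual_normZ dual_norm0_eq0.

Lemma dual_normE (f : dual) : `|f| = dual_norm f.
Proof. by []. Qed.

End Dual.

Section CanonicalEmbedding.
Context {R : realType} (X : normedModType R).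

Lemma eval_cont_lin (x : X) : (fun f : dual X => f x) \in @cont_lin R (dual X).
Proof.
apply/asboolP.
have lin : linear (fun f : dual X => f x : R^o) by [].
split => //.
pose lf := GRing.isLinear.Build R (dual X) R^o *:%R _ lin.
pose F : {linear dual X -> R^o} := HB.pack (fun f : dual X => f x : R^o) lf.
apply: (@bounded_linear_continuous R (dual X) R^o F).
apply/bounded_funP => r; exists (r * `|x|) => f fr.
by rewrite (le_trans (dual_normP f x))// ler_wpM2r.
Qed.

Definition canonical_embedding (x : X) : dual (dual X) := Dual (eval_cont_lin x).

End CanonicalEmbedding.

Section Subspaces.
Context {R : realType}.

Definition linear_subspace (V : lmodType R) (Z : set V) : Prop :=
  Z 0 /\ forall (a : R) (x y : V), Z x -> Z y -> Z (a *: x + y).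

(* dim (V / Z) < oo: the classes of finitely many vectors span V / Z. *)
Definition finite_codim (V : lmodType R) (Z : set V) : Prop :=
  exists (n : nat) (v : 'I_n -> V),
    forall x : V, exists a : 'I_n -> R, Z (x - \sum_(i < n) a i *: v i).

Definition quasi_reflexive (Y : normedModType R) : Prop :=
  finite_codim (range (@canonical_embedding R Y)).

End Subspaces.

(* All the sets below are bounded, and the only possible empty one is the
   sphere of the zero space, for which sup set0 = 0. *)
Section AsymptoticUniformSmoothness.
Context {R : realType} (X : normedModType R).

Definition sphere (Z : set X) : set X := [set z | Z z /\ `|z| = 1].

Definition aus_modulus_sub (t : R) (x : X) (Z : set X) : R :=
  if `[< Z = [set 0] >] then 0
  else sup [set `|x + t *: z| - 1 | z in sphere Z].

Definition aus_modulus_at (t : R) (x : X) : R :=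
  inf [set aus_modulus_sub t x Z |
       Z in [set Z | [/\ linear_subspace Z, closed Z & finite_codim Z]]].

Definition aus_modulus (t : R) : R :=
  sup [set aus_modulus_at t x | x in sphere setT].

Definition p_AUS (p : R) : Prop :=
  exists2 c : R, 0 < c & forall t : R, 0 <= t -> aus_modulus t <= c * t `^ p.

End AsymptoticUniformSmoothness.

Definition Gk (k : nat) (M : set nat) : set (k.-tuple nat) :=
  [set n : k.-tuple nat | sorted ltn n /\ forall i : 'I_k, M (tnth n i)].
Arguments Gk : clear implicits.

Definition Gk_dist (k : nat) (n m : k.-tuple nat) : nat :=
  #|[pred j : 'I_k | tnth n j != tnth m j]|.

Definition Ik (k : nat) (M : set nat) : set (k.-tuple nat * k.-tuple nat) :=
  [set nm | [/\ Gk k M nm.1, Gk k M nm.2,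
    forall i : 'I_k, (tnth nm.1 i < tnth nm.2 i)%N &
    forall i j : 'I_k, j = i.+1 :> nat -> (tnth nm.2 i < tnth nm.1 j)%N]].
Arguments Ik : clear implicits.

Section Lipschitz.
Context {R : realType} (V : normedModType R) (k : nat) (M : set nat).

(* 0 <= L matters only when Gk k M is a single point, i.e. k = 0. *)
Definition lip_bound (f : Gk k M -> V) (L : R) : Prop :=
  0 <= L /\
  forall n m : Gk k M, `|f n - f m| <= L * (Gk_dist (val n) (val m))%:R.

Definition is_lipschitz (f : Gk k M -> V) : Prop := exists L, lip_bound f L.

Definition Lip (f : Gk k M -> V) : R := inf (lip_bound f).

End Lipschitz.

(* Main.v *)
(* Take a free ultrafilter U on the naturals containing M and let f_j(n_1..n_j)
   be the iterated weak* limit of f along U in the variables n_(j+1), ..., n_k.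
   For U-generic interlaced n and m put x_j = f_j(n_1..n_j) - f_j(m_1..m_j); then
   x_(j+1) - x_j has norm at most 2 Lip f and is as weak*-small as we like.
   Since Y has finite codimension in its bidual, a bounded projection along Y
   takes values in a finite dimensional space; its iterated limits along n and m
   agree, so x_j is arbitrarily close to Y.  Asymptotic uniform smoothness at a
   point of Y, carried to weak*-small vectors of the bidual by Helly's theorem,
   then gives |x_(j+1)| <= B (1 + c (T / B)^p) + small whenever |x_j| <= B, with T
   slightly above 2 Lip f.  The sequence B_j = K T (j + 1)^(1/p) is a supersolution
   of this recursion.  Finally a diagonal argument turns "U-generic" into "in an
   infinite M'". *)

From HB Require Import structures.
Require Import Defs.
From mathcomp Require Import all_boot all_order all_algebra.
From mathcomp Require Import all_classical all_reals all_analysis.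
From mathcomp Require Import ring lra.
Set Implicit Arguments.
Unset Strict Implicit.
Unset Printing Implicit Defensive.
Import Order.TTheory GRing.Theory Num.Theory.
Import numFieldNormedType.Exports.
Local Open Scope classical_set_scope.
Local Open Scope ring_scope.

(** * Hahn-Banach theorem and duals *)

(** Zorn's lemma on graphs of partial linear functionals dominated by [q], ordered by inclusion: a
    maximal graph is total, since otherwise it extends by one more dimension. *)
Lemma hahn_banach_seminorm (R : realType) (V : lmodType R) (q : V -> R) (v0 : V) :
  (forall x y, q (x + y) <= q x + q y) ->
  (forall a x, q (a *: x) = `|a| * q x) ->
  exists l : V -> R^o, [/\ linear l, forall x, `|l x| <= q x & l v0 = q v0].
Proof.
move=> qD qZ.
have q0 : q 0 = 0 by rewrite -(scale0r (0 : V)) qZ normr0 mul0r.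
have qN x : q (- x) = q x by rewrite -scaleN1r qZ normrN normr1 mul1r.
(* The empty graph must qualify, being the union of the empty chain, so the point over [v0] is
   demanded only of nonempty graphs. *)
pose P := [set G : set (V * R) | [/\
  forall a x y r s, G (x, r) -> G (y, s) -> G (a *: x + y, a * r + s),
  forall x r, G (x, r) -> r <= q x & G !=set0 -> G (v0, q v0)]].
have [F FP Ftot|G [[Glin Gq Gv0] Gmax]] := @Zorn_bigcup _ P.
  split.
  - move=> a x y r s [A FA Ax] [B FB By].
    have [AB|BA] := Ftot _ _ FA FB.
      by exists B => //; have [+ _ _] := FP _ FB; apply => //; exact: AB.
    by exists A => //; have [+ _ _] := FP _ FA; apply => //; exact: BA.
  - by move=> x r [A FA Ax]; have [_ + _] := FP _ FA; apply.
  - move=> [z [A FA Az]]; exists A => //; have [_ _ +] := FP _ FA.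
    by apply; exists z.
have G_v0 : G (v0, q v0).
  apply: Gv0; have [//|/nonemptyPn/= G0] := pselect (G !=set0); exfalso.
  apply: (Gmax [set z | exists a : R, z = (a *: v0, a * q v0)]).
    split; first by rewrite G0.
    move=> /(_ (0, 0)); rewrite G0; apply; exists 0.
    by rewrite scale0r mul0r.
  split=> [a x y r s [b [-> ->]] [c [-> ->]]|x r [b [-> ->]]|_].
  - by exists (a * b + c); rewrite scalerA scalerDl mulrDl mulrA.
  - rewrite qZ ler_wpM2r ?ler_norm// -(pmulr_rge0 _ (ltr0n R 2)).
    by have := qD v0 (- v0); rewrite qN subrr q0; lra.
  - by exists 1; rewrite scale1r mul1r.
have G0 : G (0, 0).
  by have := Glin (-1) _ _ _ _ G_v0 G_v0; rewrite scaleN1r mulN1r !addNr.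
have GZ a x r : G (x, r) -> G (a *: x, a * r).
  by move=> /(Glin a) /(_ G0); rewrite !addr0.
have GN x r : G (x, r) -> G (- x, - r).
  by move=> /(GZ (-1)); rewrite scaleN1r mulN1r.
have GD x y r s : G (x, r) -> G (y, s) -> G (x + y, r + s).
  by move=> /(Glin 1) H /H; rewrite scale1r mul1r.
have Gabs x r : G (x, r) -> `|r| <= q x.
  by move=> Gx; rewrite ler_norml lerNl (Gq _ _ Gx) -qN (Gq _ _ (GN _ _ Gx)).
have Gfun x r s : G (x, r) -> G (x, s) -> r = s.
  move=> Gr /GN Gs; have := Gabs _ _ (GD _ _ _ _ Gr Gs).
  by rewrite subrr q0 normr_le0 subr_eq0 => /eqP.
have Gtot x : exists r, G (x, r).
  apply: contrapT => Gx.
  (* The value at [x] has to lie above every [s - q (y - x)] and below every [q (y + x) - s]; the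
     supremum of the lower family does. *)
  pose S := [set u | exists y s, G (y, s) /\ s - q (y - x) = u].
  have ubS : ubound S (q x).
    move=> _ [y [s [Gs <-]]]; have := Gq _ _ Gs.
    by have := qD (y - x) x; rewrite subrK; lra.
  pose c := sup S.
  have S0 : S !=set0 by exists (0 - q (0 - x)), 0, 0.
  have c1 y s : G (y, s) -> s - q (y - x) <= c.
    move=> Gs; apply: ub_le_sup; first by exists (q x).
    by exists y, s.
  have c2 y s : G (y, s) -> c <= q (y + x) - s.
    move=> Gs; apply: ge_sup => // _ [z [t [Gt <-]]].
    have := Gq _ _ (GD _ _ _ _ Gs Gt).
    have := qD (y + x) (z - x); rewrite addrACA subrr addr0; lra.
  apply: (Gmax [set z | exists a y s, G (y, s) /\ z = (y + a *: x, s + a * c)]).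
    split.
      move=> [y s] Gy; exists 0, y, s.
      by rewrite scale0r mul0r !addr0.
    move=> H; apply: Gx; exists c; apply: H; exists 1, 0, 0.
    by rewrite scale1r mul1r !add0r.
  split=> [a y z r s|y r|_].
  - move=> [b [y' [r' [G1 [-> ->]]]]] [b' [z' [s' [G2 [-> ->]]]]].
    exists (a * b + b'), (a *: y' + z'), (a * r' + s'); split; first exact: Glin.
    congr (_, _); last by ring.
    by rewrite scalerDr scalerDl scalerA addrACA.
  - move=> [b [y' [r' [G1 [-> ->]]]]].
    have [b0|b0|->] := ltgtP b 0.
    + have nb : 0 < - b by rewrite oppr_gt0.
      have := c1 _ _ (GZ (- b)^-1 _ _ G1).
      have -> : (- b)^-1 *: y' - x = (- b)^-1 *: (y' + b *: x).
        by rewrite scalerDr scalerA invrN mulNr mulVf ?lt_eqF// scaleN1r.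
      rewrite qZ gtr0_norm ?invr_gt0// -mulrBr mulrC ler_pdivrMr//; lra.
    + have := c2 _ _ (GZ b^-1 _ _ G1).
      have -> : b^-1 *: y' + x = b^-1 *: (y' + b *: x).
        by rewrite scalerDr scalerA mulVf ?gt_eqF// scale1r.
      rewrite qZ gtr0_norm ?invr_gt0// -mulrBr mulrC ler_pdivlMr//; lra.
    + by rewrite scale0r mul0r !addr0; exact: Gq.
  - by exists 0, v0, (q v0); rewrite scale0r mul0r !addr0.
have [l lP] := choice Gtot.
exists l; split=> [a x y|x|]; [|exact: Gabs|].
  by apply: (Gfun (a *: x + y)) => //; exact: Glin.
by apply: (Gfun v0).
Qed.

Section functionals.
Context {R : realType} (X : normedModType R).

Lemma bounded_cont_lin (l : X -> R^o) (M : R) :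
  linear l -> (forall x, `|l x| <= M * `|x|) -> l \in @cont_lin R X.
Proof.
move=> ll lM; apply/asboolP; split => //.
pose lf := GRing.isLinear.Build R X R^o *:%R _ ll.
pose F : {linear X -> R^o} := HB.pack l lf.
apply: (@bounded_linear_continuous R X R^o F); apply/bounded_funP => r.
exists (`|M| * r) => x xr.
rewrite (le_trans (lM x))// (le_trans (ler_wpM2r (normr_ge0 x) (ler_norm M)))//.
by rewrite ler_wpM2l.
Qed.

Lemma dual_of_bounded (l : X -> R^o) (M : R) :
  linear l -> (forall x, `|l x| <= M * `|x|) ->
  exists f : dual X, forall x, f x = l x.
Proof. by move=> ll lM; exists (Dual (bounded_cont_lin ll lM)). Qed.

Lemma dual_norming (x0 : X) :
  exists f : dual X, `|f| <= 1 /\ f x0 = `|x0|.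
Proof.
have [l [ll lM lx0]] := hahn_banach_seminorm x0 (@ler_normD _ X) (@normrZ _ X).
have [|f fl] := dual_of_bounded (M := 1) ll; first by move=> x; rewrite mul1r.
exists f; rewrite fl lx0; split => //.
by apply: dual_norm_le => x x1; rewrite fl (le_trans (lM _)).
Qed.

Lemma dualN (f : dual X) x : f (- x) = - f x.
Proof. by rewrite -scaleN1r dualZ mulN1r. Qed.

Lemma dualD (f : dual X) x y : f (x + y) = f x + f y.
Proof. by have := dual_linear f 1 x y; rewrite !scale1r. Qed.

Lemma dualB (f : dual X) x y : f (x - y) = f x - f y.
Proof. by rewrite dualD dualN. Qed.

Lemma dual_sum n (f : dual X) (F : 'I_n -> X) :
  f (\sum_i F i) = \sum_i f (F i).
Proof. by apply: (big_morph f (dualD f) (dual0 f)). Qed.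

Lemma dual_subE (f g : dual X) x : (f - g) x = f x - g x.
Proof. by []. Qed.

Lemma dual_sumE n (f : 'I_n -> dual X) x : (\sum_i f i) x = \sum_i f i x.
Proof. by apply: (big_morph (fun g : dual X => g x : R)). Qed.

Lemma dual_norm_apply (f : dual X) x : `|f x| <= `|f| * `|x|.
Proof. exact: dual_normP. Qed.

Lemma canonical_embedding_norm (x : X) : `|canonical_embedding x| = `|x|.
Proof.
apply/eqP; rewrite eq_le; apply/andP; split.
  apply: dual_norm_le => f f1 /=.
  by rewrite (le_trans (dual_norm_apply f x))// ler_piMl.
have [f [f1 fx]] := dual_norming x.
by rewrite -[leLHS]normr_id -fx; apply: (dual_norm_ub (canonical_embedding x)).
Qed.

Lemma canonical_embedding_linear : linear (@canonical_embedding R X).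
Proof. by move=> a x y; apply/val_inj/funext => f /=; rewrite dual_linear. Qed.

Lemma canonical_embeddingB (x y : X) :
  canonical_embedding (x - y) = canonical_embedding x - canonical_embedding y.
Proof. by apply/val_inj/funext => f /=; rewrite dualB. Qed.

End functionals.

(** * Closed subspaces of finite codimension *)

Section hahn_banach_inf.
Context {R : realType} (V : lmodType R) (K : V -> R -> Prop).
Hypotheses (K0 : forall v, exists r, K v r) (Kge0 : forall v r, K v r -> 0 <= r).
Hypothesis KD : forall v w r s, K v r -> K w s -> K (v + w) (r + s).
Hypothesis KZ : forall a v r, K v r -> K (a *: v) (`|a| * r).

(** Read [K v r] as: [r] is an admissible cost of [v]. The least cost [inf (K v)] is a seminorm, to
    which Hahn-Banach applies. It is used with the distance to a subspace and with the gauge of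
    Helly's theorem. *)
Lemma hahn_banach_inf (v0 : V) :
  exists l : V -> R^o, [/\ linear l, forall v r, K v r -> `|l v| <= r &
    forall c, (forall r, K v0 r -> c <= r) -> c <= l v0].
Proof.
pose q v := inf (K v).
have lbK v : has_lbound (K v) by exists 0 => r; exact: Kge0.
have qle v r : K v r -> q v <= r by exact: ge_inf.
have qge v c : (forall r, K v r -> c <= r) -> c <= q v.
  by move=> H; apply: lb_le_inf => //; exact: K0.
have q0 v : 0 <= q v by apply: (qge _) => r; exact: Kge0.
have qD v w : q (v + w) <= q v + q w.
  rewrite -lerBlDr; apply: (qge v) => r Kr.
  suff : q (v + w) - r <= q w by lra.
  by apply: (qge _) => s Ks; have := qle _ _ (KD Kr Ks); lra.
have qZle a v : q (a *: v) <= `|a| * q v.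
  have [->|a0] := eqVneq a 0.
    have [r Kr] := K0 v; rewrite normr0 mul0r.
    by have := qle _ _ (KZ 0 Kr); rewrite normr0 mul0r.
  rewrite -ler_pdivrMl ?normr_gt0//; apply: (qge v) => r Kr.
  by rewrite ler_pdivrMl ?normr_gt0//; exact/qle/KZ.
have qZ a v : q (a *: v) = `|a| * q v.
  apply/eqP; rewrite eq_le qZle/=; have [->|a0] := eqVneq a 0.
    by rewrite normr0 mul0r.
  rewrite -ler_pdivlMl ?normr_gt0// -normfV (le_trans _ (qZle _ _))//.
  by rewrite scalerA mulVf// scale1r.
have [l [ll lq lv0]] := hahn_banach_seminorm v0 qD qZ.
exists l; split => // [v r Kr|c]; first exact: (le_trans (lq v) (qle _ _ Kr)).
by move=> cK; rewrite lv0; exact: qge.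
Qed.

End hahn_banach_inf.

Section closed_subspaces.
Context {R : realType} (V : normedModType R).

(** The seminorm is the distance to [Z], positive at [v] because [Z] is closed. A functional
    dominated by it vanishes on [Z]; it is then normalised at [v]. *)
Lemma separating_functional (Z : set V) (v : V) :
  linear_subspace Z -> closed Z -> ~ Z v ->
  exists g : dual V, (forall z, Z z -> g z = 0) /\ g v = 1.
Proof.
move=> [Z0 Zlin] cZ Zv.
have ZZ a x : Z x -> Z (a *: x) by move=> /(Zlin a _ 0) /(_ Z0); rewrite addr0.
have ZD x y : Z x -> Z y -> Z (x + y) by move=> /(Zlin 1); rewrite scale1r; apply.
have [e e0 ve] : exists2 e : R, 0 < e & forall z, Z z -> e <= `|v - z|.
  have : nbhs v (~` Z) by apply: open_nbhs_nbhs; split => //; exact: closed_openC.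
  move=> /nbhs_ballP[e /= e0 be]; exists e => // z Zz; rewrite leNgt.
  by apply/negP => ze; apply: (be z) => //; rewrite -ball_normE.
pose K (x : V) (r : R) := exists2 z, Z z & `|x - z| <= r.
have [| | | |l [ll lK lv]] := @hahn_banach_inf R V K _ _ _ _ v.
- by move=> x; exists `|x - 0|, 0.
- by move=> x r [z _ /(le_trans (normr_ge0 _))].
- move=> x y r s [z Zz zr] [w Zw ws]; exists (z + w); first exact: ZD.
  by rewrite opprD addrACA (le_trans (ler_normD _ _))// lerD.
- move=> a x r [z Zz zr]; exists (a *: z); first exact: ZZ.
  by rewrite -scalerBr normrZ ler_wpM2l.
have lv0 : 0 < l v.
  by apply: (lt_le_trans e0); apply: lv => r [z Zz /(le_trans _)]; apply; exact: ve.
have [|f fl] := dual_of_bounded (M := 1) ll.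
  by move=> x; rewrite mul1r; apply: lK; exists 0 => //; rewrite subr0.
exists ((l v)^-1 *: f); split => [z Zz|].
  have /eqP lz : l z == 0.
    by rewrite -normr_le0; apply: lK; exists z => //; rewrite subrr normr0.
  by rewrite dual_scaleE fl lz mulr0.
by rewrite dual_scaleE fl mulVf// gt_eqF.
Qed.

(** Coordinates modulo [Z] can be chosen continuous. By induction: a first vector lying in [Z] gets
    coordinate 0; otherwise a functional [g] that vanishes on [Z] and is 1 at that vector shows that
    [Z] plus its line is a closed subspace [Z1], spanned modulo itself by the remaining vectors. *)
Lemma closed_finite_codim_coord n (v : 'I_n -> V) (Z : set V) :
  linear_subspace Z -> closed Z ->
  (forall x, exists a : 'I_n -> R, Z (x - \sum_(i < n) a i *: v i)) ->
  exists f : 'I_n -> dual V, forall x, Z (x - \sum_(i < n) f i x *: v i).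
Proof.
elim: n v Z => [|n IHn] v Z lZ cZ Zv.
  exists (fun=> 0) => x; have [a] := Zv x.
  by rewrite !big_ord0.
pose v' i := v (lift ord0 i).
have [Zv0|/(separating_functional lZ cZ)[g [gZ gv]]] := pselect (Z (v ord0)).
  have [x|f Zf] := IHn v' Z lZ cZ.
    have [a Za] := Zv x; exists (fun i => a (lift ord0 i)).
    move: Za; rewrite big_ord_recl => /(lZ.2 (a ord0) _ _ Zv0).
    by rewrite opprD addrCA addNKr.
  exists (fun i => oapp f 0 (unlift ord0 i)) => x.
  rewrite big_ord_recl unlift_none /= scale0r add0r.
  by under eq_bigr do rewrite liftK /=; exact: Zf.
pose Z1 := [set x | Z (x - g x *: v ord0)].
have lZ1 : linear_subspace Z1.
  split; first by rewrite /Z1 /= dual0 scale0r subr0; exact: lZ.1.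
  move=> a x y Zx Zy; rewrite /Z1 /=; have := lZ.2 a _ _ Zx Zy.
  by rewrite dual_linear scalerDl scalerBr scalerA opprD addrACA.
have cZ1 : closed Z1.
  apply: (@closed_comp _ _ (fun x => x - g x *: v ord0) Z) => // x _.
  apply: cvgB; first exact: cvg_id.
  by apply: cvgZ; [exact: dual_continuous|exact: cvg_cst].
have [x|f Zf] := IHn v' Z1 lZ1 cZ1.
  have [a Za] := Zv x; exists (fun i => a (lift ord0 i)); rewrite /Z1 /=.
  move: Za; rewrite big_ord_recl opprD addrA addrAC -/v'.
  set y := x - _ => Za; have /eqP := gZ _ Za.
  by rewrite dualB dualZ gv mulr1 subr_eq0 => /eqP ->.
(* [f0 x] is the value of [g] at what the other coordinates leave of [x], that is, the coefficient
   of that remainder along [v ord0]. *)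
pose f0 := g - \sum_j g (v' j) *: f j.
exists (fun i => oapp f f0 (unlift ord0 i)) => x.
rewrite big_ord_recl unlift_none -[oapp _ _ None]/f0.
under eq_bigr do rewrite liftK -[oapp _ _ (Some _)]/(f _).
have := Zf x; rewrite /Z1 /= opprD addrA addrAC -/v'.
have -> // : g (x - \sum_i f i x *: v' i) = f0 x.
rewrite dual_subE dualB dual_sumE dual_sum.
by congr (_ - _); apply: eq_bigr => i _; rewrite dualZ dual_scaleE mulrC.
Qed.

End closed_subspaces.

(** The embedding is isometric and [Y] complete: the sets of points whose image is within [e] of
    [xi] generate a Cauchy filter, and its limit is sent to [xi]. *)
Lemma closed_canonical_range (R : realType) (Y : completeNormedModType R) :
  closed (range (@canonical_embedding R Y)).
Proof.
move=> xi xicl.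
have near_xi (e : R) : 0 < e -> exists y : Y, `|xi - canonical_embedding y| < e.
  move=> e0; have [_ [[y _ <-]]] := xicl _ (nbhsx_ballx xi e e0).
  by rewrite -ball_normE; exists y.
pose F := filter_from [set e : R | 0 < e]
  (fun e => [set y : Y | `|xi - canonical_embedding y| < e]).
have FF : ProperFilter F.
  apply: filter_from_proper; last exact: near_xi.
  apply: filter_from_filter; first by exists 1 => /=.
  move=> e d /= e0 d0; exists (Num.min e d); first by rewrite /= lt_min e0.
  by move=> y /=; rewrite lt_min => /andP[].
have /cauchy_cvg Fy : cauchy F.
  apply: cauchy_exP => e e0; have e2 : 0 < e / 2 by rewrite divr_gt0.
  have [y ye] := near_xi _ e2; exists y, (e / 2) => // z /= ze.
  rewrite -ball_normE /= -canonical_embedding_norm canonical_embeddingB.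
  have := ler_distD xi (canonical_embedding y) (canonical_embedding z).
  by rewrite distrC in ye; lra.
exists (lim F) => //; apply/eqP; rewrite eq_sym -subr_eq0 -normr_le0.
apply/ler_addgt0Pl => e e0; rewrite addr0.
have e2 : 0 < e / 2 by rewrite divr_gt0.
have Fball : F (ball (lim F) (e / 2)) by apply: Fy; exact: nbhsx_ballx.
have Fxi : F [set y : Y | `|xi - canonical_embedding y| < e / 2] by exists (e / 2).
have [y [+ /= yxi]] := filter_ex (filterI Fball Fxi).
rewrite -ball_normE /= distrC -canonical_embedding_norm canonical_embeddingB => yl.
have := ler_distD (canonical_embedding y) xi (canonical_embedding (lim F)); lra.
Qed.

(** * Helly's theorem *)

(** Give a vector [v] of prescribed values the least cost of [x], namely its norm plus [N] times its
    total error. A linear form [l] dominated by this cost yields a combination [psi] of the [phi i]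
    of norm at most 1, so [l v0 = xi psi] is at most the norm of [xi]. Hence the cost of [v0] is
    too, and some [x] comes within [e] of it. *)
Lemma helly_approx (R : realType) (X : normedModType R) n (phi : 'I_n -> dual X)
    (xi : dual (dual X)) (e : R) : 0 < e ->
  exists x : X, `|x| <= `|xi| + e /\ forall i, `|phi i x - xi (phi i)| <= e.
Proof.
(* The penalty is such that a total cost of at most [|xi| + e] forces a total error of at most
   [e]. *)
move=> e0; pose N := (`|xi| + e) / e.
have N0 : 0 < N by rewrite divr_gt0// ltr_wpDl.
pose K (v : 'rV[R]_n) r := exists x : X, `|x| + N * \sum_i `|phi i x - v 0 i| <= r.
pose v0 := \row_i (xi (phi i) : R).
have [| | | |l [ll lK lv]] := @hahn_banach_inf R _ K _ _ _ _ v0.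
- by move=> v; eexists; exists 0.
- move=> v r [x]; apply: le_trans; rewrite addr_ge0//.
  by rewrite mulr_ge0 ?(ltW N0)// sumr_ge0.
- move=> v w r s [x xr] [y ys]; exists (x + y).
  rewrite (le_trans _ (lerD xr ys))// addrACA -mulrDr lerD ?ler_normD//.
  rewrite ler_pM2l// -big_split/=; apply: ler_sum => i _.
  by rewrite dualD mxE opprD addrACA ler_normD.
- move=> a v r [x xr]; exists (a *: x).
  rewrite (le_trans _ (ler_wpM2l _ xr))// mulrDr normrZ mulrCA lerD2l.
  rewrite ler_pM2l// mulr_sumr; apply: ler_sum => i _.
  by rewrite dualZ mxE -mulrBr normrM.
pose lf := GRing.isLinear.Build R 'rV[R]_n R^o *:%R _ ll.
pose L : {linear 'rV[R]_n -> R^o} := HB.pack l lf.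
have lE v : l v = \sum_i v 0 i * l (delta_mx 0 i).
  rewrite {1}(row_sum_delta v) -[l _]/(L _) linear_sum.
  by apply: eq_bigr => i _; rewrite linearZ.
pose psi := \sum_i (l (delta_mx 0 i) : R) *: phi i.
have psi1 : `|psi| <= 1.
  apply: dual_norm_le => x x1; rewrite dual_sumE.
  have -> : \sum_i (l (delta_mx 0 i) *: phi i) x = l (\row_i phi i x).
    by rewrite lE; apply: eq_bigr => i _; rewrite mxE mulrC.
  apply: lK; exists x; rewrite big1 ?mulr0 ?addr0// => i _.
  by rewrite mxE subrr normr0.
have lxi : l v0 <= `|xi|.
  have -> : l v0 = xi psi.
    by rewrite lE dual_sum; apply: eq_bigr => i _; rewrite mxE dualZ mulrC.
  by rewrite (le_trans (ler_norm _))// (le_trans (dual_norm_apply _ _))// ler_piMr.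
have [x xN] : exists x : X,
    `|x| + N * \sum_i `|phi i x - xi (phi i)| < `|xi| + e.
  apply: contrapT => H; have : `|xi| + e <= l v0.
    apply: lv => r [x xr]; rewrite leNgt; apply/negP => re; apply: H; exists x.
    apply: le_lt_trans re; apply: le_trans xr.
    by rewrite lerD2l ler_pM2l//; apply: ler_sum => i _; rewrite mxE.
  by move=> /le_trans /(_ lxi); lra.
have s0 : 0 <= \sum_i `|phi i x - xi (phi i)| by rewrite sumr_ge0.
exists x; split.
  by have := mulr_ge0 (ltW N0) s0; lra.
move=> i; have si : `|phi i x - xi (phi i)| <= \sum_i `|phi i x - xi (phi i)|.
  by rewrite (bigD1 i)//= lerDl sumr_ge0.
rewrite (le_trans si)// -(ler_pM2l N0) /N divfK ?gt_eqF// -/N.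
by have := normr_ge0 x; lra.
Qed.

(** * Asymptotic uniform smoothness *)

Section asymptotic_smoothness.
Context {R : realType} (X : normedModType R).

Definition aus_subspace (Z : set X) :=
  [/\ linear_subspace Z, closed Z & finite_codim Z].

Lemma aus_subspaceT : aus_subspace setT.
Proof.
split; [by []|exact: closedT|].
by exists 0, (fun=> 0) => x; exists (fun=> 0).
Qed.

(** The bound by [t] makes the later infimum over subspaces and supremum over the sphere genuine, as
    [inf] and [sup] return a default value on unbounded sets. *)
Lemma aus_modulus_sub_bounds (t : R) (x : X) (Z : set X) :
    0 <= t -> `|x| = 1 -> linear_subspace Z ->
  `|aus_modulus_sub t x Z| <= t /\
  forall z, Z z -> `|z| = 1 -> `|x + t *: z| <= 1 + aus_modulus_sub t x Z.
Proof.
move=> t0 x1 [Z0 Zlin]; rewrite /aus_modulus_sub; case: asboolP => [ZE|ZN].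
  by split=> [|z]; rewrite ?normr0// ZE => -> /eqP; rewrite normr0 eq_sym oner_eq0.
set S := [set _ | _ in _].
have Sbound r : S r -> - t <= r <= t.
  move=> [z [Zz z1] <-].
  have tz : `|t *: z| = t by rewrite normrZ z1 mulr1 ger0_norm.
  have := ler_normD x (t *: z); have := ler_normB (x + t *: z) (t *: z).
  by rewrite addrK tz x1 => *; apply/andP; split; lra.
have S0 : S !=set0.
  have [z Zz z0] : exists2 z, Z z & z != 0.
    apply: contrapT => H; apply: ZN; apply/seteqP; split=> [z Zz|_ -> //].
    by apply/eqP; apply/negPn/negP => z0; apply: H; exists z.
  exists (`|x + t *: (`|z|^-1 *: z)| - 1), (`|z|^-1 *: z) => //; split.
    by rewrite -[_ *: z]addr0; exact: Zlin.
  by rewrite normrZ gtr0_norm ?invr_gt0 ?normr_gt0// mulVf// normr_eq0.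
have ubS : has_ubound S by exists t => r /Sbound /andP[].
split=> [|z Zz z1].
  rewrite ler_norml; apply/andP; split.
    have [r Sr] := S0; have /andP[tr _] := Sbound _ Sr.
    by apply: le_trans tr _; exact: ub_le_sup.
  by apply: ge_sup => // r /Sbound /andP[].
rewrite -lerBlDl; apply: ub_le_sup => //.
by exists z.
Qed.

Lemma aus_modulus_attained (c p t e : R) (x : X) :
    (forall t, 0 <= t -> aus_modulus X t <= c * t `^ p) ->
    0 <= t -> 0 < e -> `|x| = 1 ->
  exists2 Z, aus_subspace Z &
    forall z, Z z -> `|z| = 1 -> `|x + t *: z| <= 1 + c * t `^ p + e.
Proof.
move=> cp t0 e0 x1.
pose A (y : X) := [set aus_modulus_sub t y Z | Z in aus_subspace].
have lbA (y : X) : `|y| = 1 -> has_lbound (A y).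
  move=> y1; exists (- t) => _ [Z [lZ _ _] <-].
  by have [+ _] := aus_modulus_sub_bounds t0 y1 lZ; rewrite ler_norml => /andP[].
have At (y : X) : `|y| = 1 -> aus_modulus_at t y <= t.
  move=> y1; have [lT _ _] := aus_subspaceT.
  have [+ _] := aus_modulus_sub_bounds t0 y1 lT.
  rewrite ler_norml => /andP[_]; apply: le_trans.
  by apply: ge_inf; [exact: lbA|exists setT => //; exact: aus_subspaceT].
have [_ [Z aZ <-] Ze] : exists2 r, A x r & r < aus_modulus_at t x + e.
  apply: inf_adherent => //; split; last exact: lbA.
  by exists (aus_modulus_sub t x setT), setT => //; exact: aus_subspaceT.
exists Z => // z Zz z1; have [lZ _ _] := aZ.
have [_ /(_ z Zz z1)] := aus_modulus_sub_bounds t0 x1 lZ.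
have : aus_modulus_at t x <= aus_modulus X t.
  apply: ub_le_sup; last by exists x.
  by exists t => _ [y [_ y1] <-]; exact: At.
by have := cp t t0; lra.
Qed.

(* [x + z] is a combination of [B e + T w] and [B e - T w], for the unit vectors
   [e] and [w] directing [x] and [z], whose coefficients have total mass
   [max (|x| / B, |z| / T)]. *)
Lemma aus_ball (c p B T e : R) (x : X) : 0 <= c ->
    (forall t, 0 <= t -> aus_modulus X t <= c * t `^ p) ->
    0 < T -> T <= B -> 0 < e -> `|x| <= B ->
  exists2 Z, aus_subspace Z & forall z, Z z -> `|z| <= T ->
    `|x + z| <= B * (1 + c * (T / B) `^ p) + e.
Proof.
move=> c0 cp T0 TB e0 xB; have B0 : 0 < B by exact: lt_le_trans TB.
set D := 1 + c * (T / B) `^ p.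
have D1 : 1 <= D by rewrite lerDl mulr_ge0 ?powR_ge0.
have BD : B <= B * D by rewrite ler_peMr// ltW.
(* The origin has no direction; there [z] alone has norm at most [T <= B]. *)
have [x0|x0] := eqVneq x 0.
  exists setT; first exact: aus_subspaceT.
  by move=> z _ zT; rewrite x0 add0r; lra.
have nx0 : 0 < `|x| by rewrite normr_gt0.
pose u := `|x|^-1 *: x.
have u1 : `|u| = 1 by rewrite normrZ gtr0_norm ?invr_gt0// mulVf// gt_eqF.
have TB0 : 0 <= T / B by rewrite divr_ge0 ?ltW.
have [|Z aZ HZ] := aus_modulus_attained cp TB0 _ u1 (e := e / B).
  by rewrite divr_gt0.
exists Z => // z Zz zT.
have [->|z0] := eqVneq z 0; first by rewrite addr0; lra.
have nz0 : 0 < `|z| by rewrite normr_gt0.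
pose w := `|z|^-1 *: z.
have w1 : `|w| = 1 by rewrite normrZ gtr0_norm ?invr_gt0// mulVf// gt_eqF.
have [[Z0 Zlin] _ _] := aZ.
have Zw : Z w by rewrite -[w]addr0; exact: Zlin.
have ZNw : Z (- w) by rewrite -[- w]addr0 -scaleN1r; exact: Zlin.
have bound v : Z v -> `|v| = 1 -> `|B *: u + T *: v| <= B * D + e.
  move=> Zv v1; have -> : B *: u + T *: v = B *: (u + (T / B) *: v).
    by rewrite scalerDr scalerA mulrCA divff ?gt_eqF// mulr1.
  rewrite normrZ gtr0_norm//.
  by have := HZ v Zv v1; rewrite -(ler_pM2l B0) mulrDr mulrCA divff ?gt_eqF// mulr1.
have b1 := bound w Zw w1.
have b2 : `|B *: u - T *: w| <= B * D + e by rewrite -scalerN bound// normrN.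
pose a := `|x| / B; pose b := `|z| / T.
have a01 : 0 <= a <= 1 by rewrite /a /b divr_ge0 ?(ltW T0) ?(ltW B0)// ler_pdivrMr// mul1r.
have b01 : 0 <= b <= 1 by rewrite /a /b divr_ge0 ?(ltW T0) ?(ltW B0)// ler_pdivrMr// mul1r.
have xE : x = `|x| *: u by rewrite scalerA divff ?gt_eqF// scale1r.
have zE : z = `|z| *: w by rewrite scalerA divff ?gt_eqF// scale1r.
clearbody u w.
have -> : x + z = ((a + b) / 2) *: (B *: u + T *: w) + ((a - b) / 2) *: (B *: u - T *: w).
  rewrite !scalerDr !scalerN !scalerA addrACA -scalerBl -scalerDl.
  have -> : (a + b) / 2 * B + (a - b) / 2 * B = `|x|.
    by rewrite /a; field; rewrite gt_eqF.
  have -> : (a + b) / 2 * T - (a - b) / 2 * T = `|z|.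
    by rewrite /b; field; rewrite gt_eqF.
  by rewrite -xE -zE.
have N0 : 0 <= B * D + e by lra.
apply: (le_trans (ler_normD _ _)).
rewrite (normrZ ((a + b) / 2)) (normrZ ((a - b) / 2)).
apply: (@le_trans _ _ ((`|(a + b) / 2| + `|(a - b) / 2|) * (B * D + e))).
  by rewrite [leRHS]mulrDl lerD// ler_wpM2l.
move: a01 b01 => /andP[a0 a1] /andP[b0 b1'].
rewrite ler_piMl// (ger0_norm (x := (a + b) / 2)); last by lra.
by have [ab|ab] := ger0P ((a - b) / 2); lra.
Qed.

(** Test the norm on [g] in the dual unit ball. Helly's theorem replaces [xi] by a point [y] of [X]
    that nearly agrees with it on [g] and on the coordinates [phi] modulo [Z]. These coordinates
    being small, [y] is close to [y - r] in [Z], where [aus_ball] applies. The data [phi] and [d]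
    depend neither on [xi] nor on [g]. *)
Lemma aus_bidual (c p B T T' e : R) (x : X) : 0 <= c ->
    (forall t, 0 <= t -> aus_modulus X t <= c * t `^ p) ->
    0 < T -> T <= B -> T' < T -> 0 < e -> `|x| <= B ->
  exists n (phi : 'I_n -> dual X) (d : R), 0 < d /\
    forall xi : dual (dual X), `|xi| <= T' -> (forall i, `|xi (phi i)| < d) ->
      `|canonical_embedding x + xi| <= B * (1 + c * (T / B) `^ p) + e.
Proof.
move=> c0 cp T0 TB TT' e0 xB.
have e2 : 0 < e / 2 by rewrite divr_gt0.
have [Z [lZ cZ [n [v Zv]]] HZ] := aus_ball c0 cp T0 TB e2 xB.
have [phi Zphi] := closed_finite_codim_coord lZ cZ Zv.
pose S := \sum_i `|v i|; have S0 : 0 <= S by rewrite sumr_ge0.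
(* The total error [d * (1 + 2 * S)] has to fit twice: into [T - T'], to keep [y - r] in the ball of
   radius [T], and into [e / 2] at the end. *)
pose m := Num.min (T - T') (e / 2); pose d := m / (1 + 2 * S).
have m0 : 0 < m by rewrite lt_min e2 subr_gt0 TT'.
have dS : d * (1 + 2 * S) = m by rewrite divfK// gt_eqF//; lra.
have d0 : 0 < d by rewrite divr_gt0//; lra.
exists n, phi, d; split => // xi xiT xid.
apply: dual_norm_le => g g1.
(* The family [F] is [g] followed by the [phi i]. *)
pose F i := oapp phi g (unlift ord0 i).
have [y [yxi yF]] := helly_approx F xi d0.
have yg : `|g y - xi g| <= d by have := yF ord0; rewrite /F unlift_none.
have yphi i : `|phi i y| <= 2 * d.
  have := yF (lift ord0 i); rewrite /F liftK /=; have := xid i.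
  by have := ler_normD (phi i y - xi (phi i)) (xi (phi i)); rewrite subrK; lra.
pose r := \sum_i phi i y *: v i.
have rS : `|r| <= 2 * d * S.
  rewrite (le_trans (ler_norm_sum _ _ _))// mulr_sumr ler_sum// => i _.
  by rewrite normrZ ler_wpM2r.
have mT : m <= T - T' by rewrite ge_min lexx.
have me : m <= e / 2 by rewrite ge_min lexx orbT.
have zT : `|y - r| <= T by have := ler_normB y r; lra.
have xz := HZ _ (Zphi y) zT.
have -> : (canonical_embedding x + xi) g = g (x + y) - (g y - xi g).
  by rewrite dualD dual_addE /=; ring.
have := ler_normB (g (x + y)) (g y - xi g).
have := dual_norm_apply g (x + y).
have := ler_normD (x + (y - r)) r; rewrite -addrA subrK => xyr.
have : `|g| * `|x + y| <= `|x + y| by rewrite ler_piMl.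
rewrite -/r in xz; lra.
Qed.

End asymptotic_smoothness.

(** * The scalar recursion *)

(** The choice of [K] makes the increment [c * (T / B) ^ p] at most [u / j]. It remains to see that
    [(1 + u / j) ^ p <= 1 + 1 / j], which is convexity of the power function between 1 and [1 + u],
    where it takes the values 1 and 2. *)
Lemma powR_step (R : realType) (p c u K T j : R) :
  1 < p -> 0 < T -> 0 <= c -> 0 < u -> (1 + u) `^ p = 2 -> K `^ p = 1 + c / u -> 0 < K ->
  1 <= j ->
  K * T * j `^ p^-1 * (1 + c * (T / (K * T * j `^ p^-1)) `^ p) <=
  K * T * (j + 1) `^ p^-1.
Proof.
move=> p1 T0 c0 u0 up Kp K0 j1.
have p0 : 0 < p by lra.
have j0 : 0 < j by lra.
have jp : 0 < j `^ p^-1 by rewrite powR_gt0.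
have KT : 0 < K * T by rewrite mulr_gt0.
have -> : T / (K * T * j `^ p^-1) = (K * j `^ p^-1)^-1.
  by field; rewrite !gt_eqF.
have -> : (K * j `^ p^-1)^-1 `^ p = ((1 + c / u) * j)^-1.
  have Kj : 0 <= K * j `^ p^-1 by rewrite mulr_ge0// ltW.
  rewrite -powR_inv1// -powRrM mulN1r powRN powRM ?(ltW K0) ?(ltW jp)// Kp.
  by rewrite -powRrM mulVf ?gt_eqF// powRr1// ltW.
rewrite -mulrA ler_pM2l//.
have cu : c * ((1 + c / u) * j)^-1 <= u * j^-1.
  rewrite ler_pdivrMr; last by rewrite mulr_gt0// ltr_wpDr// divr_ge0// ltW.
  have -> : u / j * ((1 + c / u) * j) = u + c by field; rewrite !gt_eqF.
  lra.
apply: (@le_trans _ _ (j `^ p^-1 * (1 + u * j^-1))).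
  by rewrite ler_pM2l// lerD2l.
have ij1 : 0 <= j^-1 <= 1 by rewrite invr_ge0 ltW//= invf_le1.
have -> : j + 1 = j * (1 + j^-1) by field; rewrite gt_eqF.
have /andP[i0 i1] := ij1.
rewrite powRM ?(ltW j0)//; last by lra.
rewrite ler_pM2l//.
have w0 : 0 <= 1 + u * j^-1 by rewrite addr_ge0// mulr_ge0// ltW.
have -> : 1 + u * j^-1 = (1 + u * j^-1) `^ p `^ p^-1.
  by rewrite -powRrM divff ?gt_eqF// powRr1.
apply: ge0_ler_powR; rewrite ?nnegrE ?powR_ge0 ?invr_ge0 ?(ltW p0)//; first lra.
(* Weight [j^-1] on the point [1 + u] and the rest on 1; this is a convex combination since
   [1 <= j]. *)
have := @convex_powR _ p (ltW p1) (Itv01 i0 i1) (1 + u) 1.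
rewrite !inE /= !in_itv /= !andbT => /(_ _ _)/wrap[|//|].
  lra.
rewrite convRE [X in X `^ _ <= _]convRE /= up powR1 /unstable.onem.
have -> : j^-1 * (1 + u) + (1 - j^-1) * 1 = 1 + u / j by ring.
lra.
Qed.

(** * Ultrafilter limits and generic interlaced sequences *)

Lemma ultra_bounded_cvg (R : realType) (T : Type) (U : set_system T)
    (u : T -> R) (C : R) {UU : UltraFilter U} :
  (forall a, `|u a| <= C) -> exists l : R, u a @[a --> U] --> l.
Proof.
move=> uC.
have cC : compact `[- C, C] by exact: segment_compact.
have uU : (u @ U) `[- C, C]%classic.
  by apply: (@filterE _ U _ (u @^-1` _)) => a /=; rewrite in_itv /= -ler_norml.
have [l [_ ul]] := cC _ _ uU.
exists l => B lB.
have [//|UB] := in_ultra_setVsetC (u @^-1` B) UU.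
by have [x [? ?]] := ul (~` B) B UB lB.
Qed.

Lemma cvg_norm_le (R : realType) (T : Type) (U : set_system T) (u : T -> R)
    (l C : R) {UU : ProperFilter U} : u a @[a --> U] --> l ->
  (\forall a \near U, `|u a| <= C) -> `|l| <= C.
Proof.
move=> ul uC; apply/ler_addgt0Pr => e e0.
have [a [/= la aC]] := filter_ex (filterI (cvgr_dist_lt _ _ ul _ e0) uC).
by have := ler_normD (l - u a) (u a); rewrite subrK; lra.
Qed.

Section weak_star_limits.
Context {R : realType} (X : normedModType R) (U : set_system nat).
Context {UU : UltraFilter U}.
Implicit Types g : nat -> dual X.

Definition weak_star_cvg g (xi : dual X) :=
  forall x, (g a x : R) @[a --> U] --> (xi x : R).

Definition weak_star_lim g : dual X := xget 0 [set xi | weak_star_cvg g xi].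

(** Banach-Alaoglu along an ultrafilter: pointwise limits exist by boundedness and form a linear
    functional bounded by [C]. So the default 0 of [weak_star_lim] is not taken for lack of a
    limit. *)
Lemma weak_star_lim_cvg g (C : R) : (forall a, `|g a| <= C) ->
  weak_star_cvg g (weak_star_lim g).
Proof.
move=> gC; apply: (@xgetPex _ 0 [set xi | weak_star_cvg g xi]).
have C0 : 0 <= C by exact: le_trans (normr_ge0 _) (gC 0).
have gx x a : `|g a x : R| <= C * `|x|.
  by rewrite (le_trans (dual_norm_apply _ _))// ler_wpM2r.
have /choice[l lP] x : exists l : R, (g a x : R) @[a --> U] --> l.
  exact: ultra_bounded_cvg (gx x).
have lC x : `|l x| <= C * `|x|.
  by apply: (cvg_norm_le (lP x)); apply: filterE => a; exact: gx.
have ll : linear (l : X -> R^o).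
  move=> c x y.
  have lin : (g a (c *: x + y) : R) @[a --> U] --> c * l x + l y.
    have -> : (fun a => g a (c *: x + y) : R) = (fun a => c * g a x + g a y).
      by apply/funext => a; rewrite dual_linear.
    by apply: cvgD (lP y); apply: cvgM (lP x); exact: cvg_cst.
  by apply: (cvg_unique _ (lP _) lin); exact: Rhausdorff.
have [f fl] := dual_of_bounded ll lC.
by exists f => x; rewrite fl; exact: lP.
Qed.

(** Weak* lower semicontinuity of the dual norm. *)
Lemma weak_star_cvg_le g (xi eta : dual X) (L : R) : weak_star_cvg g xi ->
  (\forall a \near U, `|eta - g a| <= L) -> `|eta - xi| <= L.
Proof.
move=> gxi gL; apply: dual_norm_le => x x1; rewrite dual_subE.
apply: (cvg_norm_le (cvgB (cvg_cst (eta x : R)) (gxi x))).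
apply: filterS gL => a /= aL.
by rewrite -[_ - _]dual_subE (le_trans (dual_norm_apply _ _))// (le_trans _ aL)// ler_piMr.
Qed.

Lemma weak_star_lim_norm g (C : R) : (forall a, `|g a| <= C) ->
  `|weak_star_lim g| <= C.
Proof.
move=> gC; have := weak_star_cvg_le (eta := 0) (weak_star_lim_cvg gC).
rewrite sub0r normrN; apply.
by apply: filterE => a; rewrite sub0r normrN.
Qed.

End weak_star_limits.

Lemma unbounded_infinite_nat (A : set nat) :
  (forall N, exists2 a, (N <= a)%N & A a) -> infinite_set A.
Proof.
move=> Abig /finite_seqP[s As]; have [a + Aa] := Abig (\max_(i <- s) i).+1.
rewrite As /= in Aa; rewrite ltnNge => /negP; apply.
by rewrite (big_rem a)//= leq_maxl.
Qed.

Lemma infinite_nat_unbounded (A : set nat) N :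
  infinite_set A -> exists2 a, (N < a)%N & A a.
Proof.
move=> Ainf; apply: contrapT => AN; apply: Ainf.
apply: sub_finite_set (finite_II N.+1) => a Aa /=; rewrite ltnNge.
by apply/negP => Na; apply: AN; exists a.
Qed.

Lemma exists_free_ultrafilter (M : set nat) : infinite_set M ->
  exists U : set_system nat,
    [/\ UltraFilter U, U M & forall N, U [set a | (N < a)%N]].
Proof.
move=> Minf.
pose F := filter_from setT (fun N => [set a | M a /\ (N < a)%N]).
have FF : ProperFilter F.
  apply: filter_from_proper => [|N _]; last first.
    by have [a Na Ma] := infinite_nat_unbounded N Minf; exists a.
  apply: filter_from_filter; first by exists 0%N.
  move=> N N' _ _; exists (maxn N N') => // a [Ma].
  by rewrite gtn_max => /andP[].
have [U [UU FU]] := ultraFilterLemma FF; exists U; split => //.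
  by apply: FU; exists 0%N => // a [].
by move=> N; apply: FU; exists N => // a [].
Qed.

Section interlaced_quantifiers.
Context (U : set_system nat) {UU : UltraFilter U}.

(* [near2 r P s t] extends [s] and [t] alternately by [r] generic entries each. *)
Fixpoint near2 r (P : seq nat -> seq nat -> Prop) (s t : seq nat) : Prop :=
  if r is r'.+1 then
    \forall a \near U, \forall b \near U, near2 r' P (rcons s a) (rcons t b)
  else P s t.

(** [near2] unfolds its first pair of quantifiers; inductions on the length of the sequences need to
    append the last one. *)
Lemma near2S r P s t :
  near2 r (fun n m => \forall a \near U, \forall b \near U,
    P (rcons n a) (rcons m b)) s t -> near2 r.+1 P s t.
Proof.
elim: r s t => //= r IHr s t; apply: filterS => a; apply: filterS => b.
exact: IHr.
Qed.

Lemma near2_and r P Q s t : near2 r P s t -> near2 r Q s t ->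
  near2 r (fun n m => P n m /\ Q n m) s t.
Proof.
elim: r s t => //= r IHr s t; apply: filterS2 => a; apply: filterS2 => b.
exact: IHr.
Qed.

Lemma near2_mono r (P Q : seq nat -> seq nat -> Prop) s t :
  (forall n m, P n m -> Q n m) -> near2 r P s t -> near2 r Q s t.
Proof.
move=> PQ; elim: r s t => [|r IHr] s t /=; first exact: PQ.
by apply: filterS => a; apply: filterS => b; exact: IHr.
Qed.

Lemma near2_forall (I : finType) (P : I -> seq nat -> seq nat -> Prop) r s t :
  (forall i, near2 r (P i) s t) -> near2 r (fun n m => forall i, P i n m) s t.
Proof.
elim: r s t => //= r IHr s t H.
have : \forall a \near U, forall i, \forall b \near U,
  near2 r (P i) (rcons s a) (rcons t b) by exact: filter_forall H.
apply: filterS => a Ha; have : \forall b \near U, forall i,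
  near2 r (P i) (rcons s a) (rcons t b) by exact: filter_forall Ha.
by apply: filterS => b; exact: IHr.
Qed.

(** [h] is the iterated limit of [g] in [r] variables, taken with one and the same ultrafilter.
    Started at [s = t], the hypothesis reads [0 < d]: the limits along both interlaced sequences
    agree. *)
Lemma near2_scalar (R : realType) (g : seq nat -> R) (C d : R) r :
  (forall s, `|g s| <= C) ->
  exists h : seq nat -> R, (forall s, `|h s| <= C) /\
    forall s t, `|h s - h t| < d -> near2 r (fun n m => `|g n - g m| < d) s t.
Proof.
move=> gC; elim: r => [|r [h [hC hP]]]; first by exists g.
have /choice[l lP] s : exists l : R, h (rcons s a) @[a --> U] --> l.
  by apply: ultra_bounded_cvg => a; exact: hC.
exists l; split=> [s|s t st /=].
  by apply: (cvg_norm_le (lP s)); exact: filterE.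
pose e := (d - `|l s - l t|) / 2.
have e0 : 0 < e by rewrite divr_gt0// subr_gt0.
have near_l q : \forall a \near U, `|l q - h (rcons q a)| < e.
  exact: cvgr_dist_lt (lP q) _ e0.
apply: filterS (near_l s) => a /= ha; apply: filterS (near_l t) => b /= hb.
apply: hP; have := ler_distD (l s) (h (rcons s a)) (h (rcons t b)).
have := ler_distD (l t) (l s) (h (rcons t b)).
by rewrite distrC in ha; rewrite /e in ha hb; lra.
Qed.

Definition increasing_in (M : set nat) (s : seq nat) :=
  sorted ltn s /\ forall a, a \in s -> M a.

Lemma sorted_rcons_ltn (s : seq nat) a :
  sorted ltn s -> (forall b, b \in s -> (b < a)%N) -> sorted ltn (rcons s a).
Proof.
case: s => //= x s xs sa; rewrite rcons_path xs /= sa//.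
by rewrite mem_last.
Qed.

Lemma increasing_in_rcons M s a : increasing_in M s -> M a ->
  (forall b, b \in s -> (b < a)%N) -> increasing_in M (rcons s a).
Proof.
move=> [ss sM] Ma sa; split; first exact: sorted_rcons_ltn.
by move=> b; rewrite mem_rcons inE => /predU1P[->//|]; exact: sM.
Qed.

Context (M : set nat).
Hypotheses (U_M : U M) (U_infty : forall N, U [set a | (N < a)%N]).

Lemma near_gt_all (s : seq nat) :
  \forall a \near U, M a /\ forall b, b \in s -> (b < a)%N.
Proof.
apply: filterS2 U_M (U_infty (\max_(i <- s) i)) => a Ma /= sa; split => // b bs.
by apply: leq_ltn_trans sa; rewrite (big_rem b)//= leq_maxl.
Qed.

Lemma near_increasing (s : seq nat) : increasing_in M s ->
  \forall a \near U, increasing_in M (rcons s a).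
Proof.
by move=> sM; apply: filterS (near_gt_all s) => a [Ma sa]; exact: increasing_in_rcons.
Qed.

Lemma near2_increasing r s t : increasing_in M s -> increasing_in M t ->
  near2 r (fun n m => [/\ increasing_in M n, increasing_in M m,
    size n = (size s + r)%N & size m = (size t + r)%N]) s t.
Proof.
elim: r s t => [|r IHr] s t sM tM /=; first by rewrite !addn0.
apply: filterS (near_increasing sM) => a sa.
apply: filterS (near_increasing tM) => b tb.
by have := IHr _ _ sa tb; rewrite !size_rcons !addSnnS.
Qed.

(** Greedy diagonal construction: each new point is chosen so that [Q] holds for every subsequence
    of the list built so far. This imposes finitely many conditions, each satisfied by almost every
    point. *)
Lemma ultrafilter_extraction (Q : seq nat -> Prop) : Q [::] ->
  (forall s, Q s -> \forall a \near U, Q (rcons s a)) ->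
  exists M' : set nat, [/\ M' `<=` M, infinite_set M' &
    forall s, increasing_in M' s -> Q s].
Proof.
move=> Q0 QS.
have /choice[next nextP] l : exists a, (forall t, subseq t l -> Q t) ->
    [/\ M a, forall b, b \in l -> (b < a)%N &
        forall t, subseq t (rcons l a) -> Q t].
  have [lQ|] := pselect (forall t, subseq t l -> Q t); last by exists 0%N.
  suff /filter_ex[a Ha] : \forall a \near U, [/\ M a, forall b, b \in l -> (b < a)%N &
      forall t, subseq t (rcons l a) -> Q t] by exists a.
  (* Boolean masks index the subsequences of [l] by a finite type, over which the filter commutes
     with the quantifier. *)
  have H : \forall a \near U, forall m : (size l).-tuple bool, Q (rcons (mask m l) a).
    apply: filter_forall => m; apply: QS; apply: lQ; exact: mask_subseq.
  apply: filterS2 (near_gt_all l) H => a [Ma la] Qa; split => // t /subseqP[m].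
  case/lastP: m => [|m b]; rewrite !size_rcons// => -[ml]; rewrite mask_rcons// => ->.
  case: b; rewrite /= ?cats1 ?cats0; last exact/lQ/mask_subseq.
  by move/eqP: ml => ml; exact: (Qa (Tuple ml)).
pose l N := iter N (fun l => rcons l (next l)) [::].
have lQ N t : subseq t (l N) -> Q t.
  elim: N t => [t|N IHN]; first by rewrite subseq0 => /eqP ->.
  by have [_ _] := nextP _ IHN.
have lM N : M (next (l N)) by have [] := nextP _ (lQ N).
have lnext N b : b \in l N -> (b < next (l N))%N.
  by have [_ + _] := nextP _ (lQ N); apply.
have l_sorted N : sorted ltn (l N).
  by elim: N => //= N IHN; apply: sorted_rcons_ltn => // b; exact: lnext.
have l_sub N N' : (N <= N')%N -> {subset l N <= l N'}.
  move=> /subnK <-; elim: (N' - N)%N => // d IHd b /IHd.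
  by rewrite addSn /= mem_rcons inE orbC => ->.
have next_l N : next (l N) \in l N.+1 by rewrite /= mem_rcons mem_head.
exists [set a | exists N, a \in l N]; split.
- move=> a [N]; elim: N => //= N IHN.
  by rewrite mem_rcons inE => /predU1P[->|/IHN].
- apply: unbounded_infinite_nat => N; exists (next (l N)); last by exists N.+1.
  by elim: N => // N IHN; apply: leq_ltn_trans IHN _; exact: lnext.
- move=> s [ss sl].
  have [N sN] : exists N, {subset s <= l N}.
    elim: s sl {ss} => [|a s IHs] sl; first by exists 0%N.
    have [|N sN] := IHs; first by move=> b bs; apply: sl; rewrite inE bs orbT.
    have [N' aN'] := sl a (mem_head _ _); exists (maxn N N') => b.
    rewrite inE => /predU1P[->|/sN]; first exact: l_sub (leq_maxr _ _) _ aN'.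
    exact: l_sub (leq_maxl _ _) _.
  (* An increasing sequence of chosen points is a subsequence of some [l N]: both it and the
     filtered list are sorted with the same elements. *)
  apply: (lQ N); have -> : s = [seq x <- l N | x \in s]; last exact: filter_subseq.
  apply: (irr_sorted_eq ltn_trans ltnn ss) => [|a].
    exact: (sorted_filter ltn_trans).
  by rewrite mem_filter; apply/idP/andP => [sa|[]//]; split => //; exact: sN.
Qed.

End interlaced_quantifiers.

(** * Iterated weak* limits *)

Section iterated_limits.
Context {R : realType} (X : normedModType R) (U : set_system nat).
Context {UU : UltraFilter U} (M : set nat).
Hypotheses (U_M : U M) (U_infty : forall N, U [set a | (N < a)%N]).
Context (F : seq nat -> dual X) (C : R).
Hypothesis FC : forall s, `|F s| <= C.

(** [r] counts the trailing variables sent to the limit: the function f_j of the outline is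
    [iter_lim (k - j)]. *)
Fixpoint iter_lim r (s : seq nat) : dual X :=
  if r is r'.+1 then weak_star_lim U (fun a => iter_lim r' (rcons s a)) else F s.

Lemma iter_lim_norm r s : `|iter_lim r s| <= C.
Proof.
by elim: r s => //= r IHr s; apply: weak_star_lim_norm => a; exact: IHr.
Qed.

Lemma iter_limS_cvg r s :
  weak_star_cvg U (fun a => iter_lim r (rcons s a)) (iter_lim r.+1 s).
Proof. by apply: (weak_star_lim_cvg (C := C)) => a; exact: iter_lim_norm. Qed.

Context (k : nat) (L : R).
Hypothesis FL : forall s a b q, size (s ++ a :: q) = k ->
  increasing_in M (s ++ a :: q) -> increasing_in M (s ++ b :: q) ->
  `|F (s ++ a :: q) - F (s ++ b :: q)| <= L.

(** The same entry [c] is appended to both sequences, so the bound for changing one entry passes to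
    the weak* limit by lower semicontinuity. *)
Lemma iter_lim_lip r s a b q : (size (s ++ a :: q) + r)%N = k ->
  increasing_in M (s ++ a :: q) -> increasing_in M (s ++ b :: q) ->
  `|iter_lim r (s ++ a :: q) - iter_lim r (s ++ b :: q)| <= L.
Proof.
elim: r q => [|r IHr] q; first by rewrite addn0; exact: FL.
move=> qk sa sb.
have lim_diff : weak_star_cvg U (fun c => iter_lim r (rcons (s ++ a :: q) c) -
    iter_lim r (rcons (s ++ b :: q) c))
    (iter_lim r.+1 (s ++ a :: q) - iter_lim r.+1 (s ++ b :: q)).
  by move=> x; apply: cvgB; exact: iter_limS_cvg.
have := weak_star_cvg_le (eta := 0) (L := L) lim_diff.
rewrite sub0r normrN; apply.
apply: filterS2 (near_increasing U_M U_infty sa) (near_increasing U_M U_infty sb).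
move=> c sac sbc; rewrite sub0r normrN !rcons_cat /= in sac sbc *.
apply: IHr => //; rewrite -qk.
by rewrite !size_cat /= size_rcons !addnS !addSn.
Qed.

(** The limit over a last entry [b] is compared with the value at [a]: each such pair differs in a
    single entry. *)
Lemma iter_lim_step_norm r s : (size s + r.+1)%N = k -> increasing_in M s ->
  \forall a \near U, `|iter_lim r (rcons s a) - iter_lim r.+1 s| <= L.
Proof.
move=> sk sM.
apply: filterS (near_increasing U_M U_infty sM) => a sa.
apply: (weak_star_cvg_le (@iter_limS_cvg r s)).
apply: filterS (near_increasing U_M U_infty sM) => b sb.
rewrite -!cats1 in sa sb *; apply: iter_lim_lip => //.
by rewrite size_cat /= addn1 addSnnS.
Qed.

Lemma iter_lim_step_weak r s (I : finType) (phi : I -> X) (d : R) : 0 < d ->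
  \forall a \near U, forall i, `|(iter_lim r (rcons s a) - iter_lim r.+1 s) (phi i)| < d.
Proof.
move=> d0; apply: filter_forall => i.
have : \forall a \near U,
  `|iter_lim r.+1 s (phi i) - iter_lim r (rcons s a) (phi i)| < d.
  exact: cvgr_dist_lt (@iter_limS_cvg r s (phi i)) _ d0.
by apply: filterS => a; rewrite dual_subE distrC.
Qed.

End iterated_limits.

(** Radial contraction by [B / (B + e)], used to bring a point of [Y] into the exact ball that
    [aus_bidual] asks for. *)
Lemma norm_approx_ball (R : realType) (V : normedModType R) (y : V) (B e : R) :
  0 < B -> 0 < e -> `|y| <= B + e -> exists y0, `|y0| <= B /\ `|y - y0| <= e.
Proof.
move=> B0 e0 yB; have Be : 0 < B + e by rewrite addr_gt0.
exists ((B / (B + e)) *: y); split.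
  rewrite normrZ gtr0_norm ?divr_gt0// mulrAC ler_pdivrMr//.
  by rewrite ler_pM2l.
have -> : y - (B / (B + e)) *: y = (e / (B + e)) *: y.
  rewrite -{1}[y]scale1r -scalerBl; congr (_ *: _).
  by field; rewrite gt_eqF.
rewrite normrZ gtr0_norm ?divr_gt0// mulrAC ler_pdivrMr//.
by rewrite ler_pM2l.
Qed.

(** * The norm recursion along generic interlaced sequences *)

Section interlaced_estimate.
Context {R : realType} (p : R) (Y : completeNormedModType R).
Hypotheses (p1 : 1 < p) (qrY : quasi_reflexive Y).
Context (c : R).
Hypotheses (c0 : 0 <= c) (ausY : forall t, 0 <= t -> aus_modulus Y t <= c * t `^ p).
Context (u K : R).
Hypotheses (u0 : 0 < u) (up : (1 + u) `^ p = 2).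
Hypotheses (K1 : 1 <= K) (Kp : K `^ p = 1 + c / u).

Context (U : set_system nat) {UU : UltraFilter U} (M : set nat).
Hypotheses (U_M : U M) (U_infty : forall N, U [set a | (N < a)%N]).
Context (F : seq nat -> dual (dual Y)) (C : R).
Hypothesis FC : forall s, `|F s| <= C.
Context (k : nat) (L T : R).
Hypothesis FL : forall s a b q, size (s ++ a :: q) = k ->
  increasing_in M (s ++ a :: q) -> increasing_in M (s ++ b :: q) ->
  `|F (s ++ a :: q) - F (s ++ b :: q)| <= L.
Hypotheses (T0 : 0 < T) (LT : 2 * L < T).

Let K0 : 0 < K. Proof. exact: lt_le_trans K1. Qed.

Let Delta r (n m : seq nat) := iter_lim U F r n - iter_lim U F r m.

(** The coordinates [beta i] of the bidual modulo [Y] need not be weak* continuous, so their values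
    on [iter_lim] get iterated scalar limits of their own. Both sequences start empty, hence these
    limits agree and the coordinates of [Delta] are small. *)
Lemma near2_canonical_range j r (d : R) : 0 < d ->
  near2 U j (fun n m => exists y : Y, `|Delta r n m - canonical_embedding y| < d)
    [::] [::].
Proof.
move=> d0; have [N [w wY]] := qrY.
have lin_range : linear_subspace (range (@canonical_embedding R Y)).
  split; first by exists 0 => //; apply/val_inj/funext => f /=; rewrite dual0.
  move=> a _ _ [x _ <-] [y _ <-]; exists (a *: x + y) => //.
  exact: canonical_embedding_linear.
have [beta betaP] := closed_finite_codim_coord lin_range (@closed_canonical_range R Y) wY.
pose S := \sum_i `|w i|; have S0 : 0 <= S by rewrite sumr_ge0.
pose e := d / (1 + S); have e0 : 0 < e by rewrite divr_gt0//; lra.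
have eS : e * (1 + S) = d by rewrite divfK// gt_eqF//; lra.
have : near2 U j (fun n m => forall i,
    `|(beta i (iter_lim U F r n) : R) - beta i (iter_lim U F r m)| < e) [::] [::].
  apply: near2_forall => i.
  have [s|h [_]] := @near2_scalar U _ _ (fun s => beta i (iter_lim U F r s) : R)
      (`|beta i| * C) e j.
    by rewrite (le_trans (dual_norm_apply _ _))// ler_wpM2l// (iter_lim_norm FC).
  by apply; rewrite subrr normr0.
apply: near2_mono => n m nm; have [y _ yE] := betaP (Delta r n m); exists y.
rewrite yE opprB addrC subrK (le_lt_trans (ler_norm_sum _ _ _))//.
apply: (@le_lt_trans _ _ (e * S)); last by lra.
rewrite mulr_sumr ler_sum// => i _; rewrite normrZ ler_wpM2r//.
by rewrite dualB ltW.
Qed.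

(** Induction on the number [j] of entries fixed in each sequence. The index [j.+1] under the root,
    rather than [j], keeps the radius at least [T] from the start, as [aus_bidual] requires. *)
Lemma near2_norm_bound j (d : R) : (j <= k)%N -> 0 < d ->
  near2 U j (fun n m => `|Delta (k - j) n m| < K * T * (j.+1)%:R `^ p^-1 + d)
    [::] [::].
Proof.
elim: j d => [|j IHj] d jk d0.
  rewrite /= /Delta subrr normr0 powR1 mulr1.
  by rewrite ltr_wpDl// mulr_ge0 ?(ltW K0)// ltW.
(* The errors add up to [d / 2]: one eighth for the distance to [Y], two for moving [y] into the
   ball, one from [aus_bidual]. *)
have d8 : 0 < d / 8 by rewrite divr_gt0.
have nil_M : increasing_in M [::] by [].
apply: near2S.
have H1 := near2_increasing (UU := UU) U_M U_infty j nil_M nil_M.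
have H2 := near2_canonical_range j (k - j) d8.
have := near2_and (UU := UU) H2 (near2_and (UU := UU) (IHj _ (ltnW jk) d8) H1).
apply: near2_mono => n m [[y xy] [xB [nM mM]]]; rewrite !add0n => nj mj.
set B := K * T * (j.+1)%:R `^ p^-1 in xB.
have kj : (k - j)%N = (k - j.+1).+1 by rewrite subnSK.
have jR : 1 <= (j.+1)%:R :> R by rewrite ler1n.
have jp : 1 <= (j.+1)%:R `^ p^-1 :> R.
  have {1}<- : 1 `^ p^-1 = 1 :> R by rewrite powR1.
  by apply: ge0_ler_powR; rewrite ?nnegrE ?invr_ge0// ltW// (lt_trans ltr01).
have TB : T <= B.
  by rewrite /B -mulrA mulrCA ler_peMr ?(ltW T0)// mulr_ege1.
have B0 : 0 < B by exact: lt_le_trans TB.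
have [||y0 [y0B yy0]] := @norm_approx_ball _ _ y B (2 * (d / 8)) B0.
- by rewrite mulr_gt0.
- have := ler_normB (Delta (k - j) n m) (Delta (k - j) n m - canonical_embedding y).
  rewrite opprB addrC subrK canonical_embedding_norm; lra.
have [N [phi [e [e0 He]]]] := aus_bidual c0 ausY T0 TB LT d8 y0B.
have e2 : 0 < e / 2 by rewrite divr_gt0.
(* [phi] and [e] depend only on [n] and [m], so the new entries can be taken generic for them. Each
   sequence contributes an increment of norm at most [L], and [2 * L < T]. *)
have step s : size s = j -> increasing_in M s -> \forall a \near U,
    `|iter_lim U F (k - j.+1) (rcons s a) - iter_lim U F (k - j.+1).+1 s| <= L /\
    forall i, `|(iter_lim U F (k - j.+1) (rcons s a) -
      iter_lim U F (k - j.+1).+1 s) (phi i)| < e / 2.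
  move=> sj sM; apply: filterI; last exact: (iter_lim_step_weak FC).
  by apply: (iter_lim_step_norm U_M U_infty FC FL) => //; rewrite sj -kj subnKC// ltnW.
apply: filterS (step _ nj nM) => a [na wa].
apply: filterS (step _ mj mM) => b [mb wb].
set fa := iter_lim U F _ (rcons n a) in na wa *.
set fb := iter_lim U F _ (rcons m b) in mb wb *.
rewrite /Delta kj in xy xB.
set fn := iter_lim U F _ n in na wa xy xB *.
set fm := iter_lim U F _ m in mb wb xy xB *.
have xiT : `|(fa - fn) - (fb - fm)| <= 2 * L.
  by have := ler_normB (fa - fn) (fb - fm); lra.
have xie i : `|((fa - fn) - (fb - fm)) (phi i)| < e.
  rewrite dual_subE; have := ler_normB ((fa - fn) (phi i)) ((fb - fm) (phi i)).
  by have := wa i; have := wb i; lra.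
have {He} := He _ xiT xie.
have Bstep := powR_step p1 T0 c0 u0 up Kp K0 jR; rewrite -/B in Bstep.
rewrite -[in (j.+2)%:R]addn1 natrD.
(* Split into a point of the ball of [Y] plus the weak*-small increment, the distance of the old
   difference to [Y], and the contraction error. *)
have -> : Delta (k - j.+1) (rcons n a) (rcons m b) =
    (canonical_embedding y0 + (fa - fn - (fb - fm))) +
    ((fn - fm - canonical_embedding y) + canonical_embedding (y - y0)).
  have -> : fn - fm - canonical_embedding y + canonical_embedding (y - y0) =
      fn - fm - canonical_embedding y0 by rewrite canonical_embeddingB addrA subrK.
  rewrite [canonical_embedding y0 + _]addrC -addrA.
  rewrite [canonical_embedding y0 + _]addrC subrK opprB addrAC.
  by rewrite [fa - fn + _]addrA subrK addrA subrK.
set z := canonical_embedding y0 + _ => zB.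
have := ler_normD z ((fn - fm - canonical_embedding y) + canonical_embedding (y - y0)).
have := ler_normD (fn - fm - canonical_embedding y) (canonical_embedding (y - y0)).
rewrite canonical_embedding_norm. lra.
Qed.

End interlaced_estimate.

(** * From generic sequences to subsets *)

Fixpoint evens (s : seq nat) : seq nat :=
  if s is a :: _ :: s' then a :: evens s' else [::].

Fixpoint odds (s : seq nat) : seq nat :=
  if s is _ :: b :: s' then b :: odds s' else [::].

Fixpoint interleave (n m : seq nat) : seq nat :=
  match n, m with
  | a :: n', b :: m' => a :: b :: interleave n' m'
  | _, _ => [::]
  end.

Lemma evens_odds_rcons2 s a b : ~~ odd (size s) ->
  evens (rcons (rcons s a) b) = rcons (evens s) a /\
  odds (rcons (rcons s a) b) = rcons (odds s) b.
Proof.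
have [j sj] := ubnP (size s).
elim: j s sj => // j IHj [|x [|y s]] //= sj; rewrite negbK => so.
by have [-> ->] := IHj s (ltnW sj) so.
Qed.

Lemma interleaveK n m : size n = size m ->
  [/\ evens (interleave n m) = n, odds (interleave n m) = m &
      size (interleave n m) = (size n).*2].
Proof.
elim: n m => [|x n IHn] [|y m] //= [] /IHn[-> -> ->].
by rewrite doubleS.
Qed.

Lemma mem_interleave n m a : a \in interleave n m -> a \in n \/ a \in m.
Proof.
elim: n m => [|x n IHn] [|y m] //=; rewrite !inE => /or3P[->|->|/IHn[]->].
- by left.
- by right.
- by rewrite orbT; left.
- by rewrite orbT; right.
Qed.

Lemma sorted_interleave n m : size n = size m ->
  (forall i, (i < size n)%N -> (nth 0 n i < nth 0 m i)%N) ->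
  (forall i, (i.+1 < size n)%N -> (nth 0 m i < nth 0 n i.+1)%N) ->
  sorted ltn (interleave n m).
Proof.
elim: n m => [|x n IHn] [|y m] //= [nm] lt1 lt2; rewrite (lt1 0%N)//=.
have := IHn m nm (fun i => lt1 i.+1) (fun i => lt2 i.+1).
case: n m {IHn lt1} nm lt2 => [|x' n] [|y' m] //= _ lt2 ->.
by rewrite (lt2 0%N).
Qed.

(** The alternating quantifiers are read as a property of the single interleaved sequence, whose
    extensions are generic one entry at a time. *)
Lemma near2_extraction (U : set_system nat) {UU : UltraFilter U} (M : set nat)
    (k : nat) (P : seq nat -> seq nat -> Prop) :
  U M -> (forall N, U [set a | (N < a)%N]) -> near2 U k P [::] [::] ->
  exists M' : set nat, [/\ M' `<=` M, infinite_set M' &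
    forall n m, size n = k -> size m = k -> increasing_in M' (interleave n m) ->
      P n m].
Proof.
move=> U_M U_infty PU.
pose E s := near2 U (k - (size s)./2) P (evens s) (odds s).
(* At odd length the quantifier over the matching entry [b] is still pending; beyond length [k.*2]
   nothing is asked. *)
pose Q s := (size s <= k.*2)%N ->
  if odd (size s) then \forall b \near U, E (rcons s b) else E s.
have [| |M' [M'M M'inf M'Q]] := ultrafilter_extraction U_M U_infty (Q := Q).
- by move=> _; rewrite /= /E subn0.
- move=> s Qs; case so: (odd (size s)).
    have [sk|ks] := leqP (size s) k.*2; last first.
      apply: filterE => a; rewrite /Q size_rcons => /ltnW.
      by rewrite leqNgt ks.
    have := Qs sk; rewrite so; apply: filterS => a Ea _.
    by rewrite size_rcons /= so.
  have [sk|ks] := ltnP (size s) k.*2; last first.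
    by apply: filterE => a; rewrite /Q size_rcons ltnNge ks.
  have := Qs (ltnW sk); rewrite so /E.
  have sk2 : ((size s)./2 < k)%N by rewrite ltn_half_double.
  rewrite -(subnSK sk2) /=; apply: filterS => a Ea _.
  rewrite size_rcons /= so /=; apply: filterS Ea => b.
  by rewrite /E !size_rcons /=; have [-> ->] := evens_odds_rcons2 a b (negbT so).
exists M'; split => // n m nk mk nm.
have [en on sn] := interleaveK (etrans nk (esym mk)).
have := M'Q _ nm; rewrite /Q sn nk leqnn odd_double => /(_ isT).
by rewrite /E sn nk doubleK subnn /= en on.
Qed.

(** * Extension of the Lipschitz map to all finite sequences *)

Section Gk_extension.
Context {R : realType} (V : normedModType R) (k : nat) (M : set nat).
Context (f : Gk k M -> V).

Definition Gk_ext (s : seq nat) : V :=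
  if pselect (exists n : Gk k M, tval (val n) = s) is left nP
  then f (projT1 (cid nP)) else 0.

Lemma Gk_extE (n : Gk k M) : Gk_ext (val n) = f n.
Proof.
rewrite /Gk_ext; case: pselect => [nP|[]]; last by exists n.
by congr f; apply/val_inj/val_inj; case: cid.
Qed.

Lemma Gk_of_seq (s : seq nat) : size s = k -> increasing_in M s ->
  exists n : Gk k M, tval (val n) = s.
Proof.
move=> /eqP sk [ss sM].
have Gs : Gk k M (Tuple sk).
  by split => // i; apply: sM; exact: mem_tnth.
by exists (SigSub (mem_set Gs)).
Qed.

(** The distance on [Gk k M] is at most [k], so the image of [f] is bounded; this is what the weak*
    limits need. *)
Lemma Gk_ext_bounded (L : R) : lip_bound f L -> exists C, forall s, `|Gk_ext s| <= C.
Proof.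
move=> [L0 fL]; have [[n0 _]|N0] := pselect (exists n0 : Gk k M, True).
  exists (`|f n0| + L * k%:R) => s; rewrite /Gk_ext.
  case: pselect => [nP|_]; last by rewrite normr0 addr_ge0// mulr_ge0.
  move: (projT1 _) => n; have := ler_normD (f n0) (f n - f n0).
  rewrite addrC subrK => /le_trans; apply; rewrite lerD2l (le_trans (fL _ _))//.
  rewrite ler_wpM2l// ler_nat -[leqRHS]card_ord; exact: max_card.
exists 0 => s; rewrite /Gk_ext; case: pselect => [nP|_]; last by rewrite normr0.
by exfalso; apply: N0; case: nP => n _; exists n.
Qed.

Lemma Gk_ext_lip (L : R) s a b q : lip_bound f L -> size (s ++ a :: q) = k ->
  increasing_in M (s ++ a :: q) -> increasing_in M (s ++ b :: q) ->
  `|Gk_ext (s ++ a :: q) - Gk_ext (s ++ b :: q)| <= L.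
Proof.
move=> [L0 fL] sk saM sbM.
have skb : size (s ++ b :: q) = k by rewrite -sk !size_cat.
have [n nE] := Gk_of_seq sk saM; have [m mE] := Gk_of_seq skb sbM.
rewrite -nE -mE !Gk_extE (le_trans (fL _ _))// ler_piMr// -[leRHS]/1%:R ler_nat.
have ltsk : (size s < k)%N by rewrite -sk size_cat /= addnS ltnS leq_addr.
(* The two sequences can differ only at position [size s], so their distance is at most 1. *)
rewrite /Gk_dist -(card1 (Ordinal ltsk)); apply: subset_leq_card.
apply/fintype.subsetP => j; rewrite !inE; apply: contraR => js.
rewrite !(tnth_nth 0%N) nE mE !nth_cat; case: ltnP => // sj.
have sj' : (size s < j)%N by rewrite ltn_neqAle eq_sym js.
by rewrite -(subnSK sj').
Qed.

Lemma Lip_ge0 : is_lipschitz f -> 0 <= Lip f.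
Proof. by move=> fl; apply: lb_le_inf => // L []. Qed.

Lemma Lip_adherent (e : R) : is_lipschitz f -> 0 < e ->
  exists2 L, lip_bound f L & L < Lip f + e.
Proof.
move=> fl e0; apply: inf_adherent => //; split => //.
by exists 0 => L [].
Qed.

End Gk_extension.

(** * Choice of constants and conclusion *)

Lemma smoothing_constants (R : realType) (p c : R) : 1 < p -> 0 <= c ->
  exists u K : R, [/\ 0 < u, (1 + u) `^ p = 2, 1 <= K & K `^ p = 1 + c / u].
Proof.
move=> p1 c0; have p0 : 0 < p by exact: lt_trans ltr01 p1.
have root x : 0 <= x -> (x `^ p^-1) `^ p = x.
  by move=> x0; rewrite -powRrM mulVf ?gt_eqF// powRr1.
have root1 : 1 `^ p^-1 = 1 :> R by rewrite powR1.
have u0 : 0 < 2 `^ p^-1 - 1 :> R.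
  rewrite subr_gt0 -[ltLHS]root1.
  by apply: gt0_ltr_powR; rewrite ?nnegrE ?invr_gt0// ltr1n.
have cu : 0 <= c / (2 `^ p^-1 - 1) by rewrite divr_ge0// ltW.
exists (2 `^ p^-1 - 1), ((1 + c / (2 `^ p^-1 - 1)) `^ p^-1); split => //.
- by rewrite addrC subrK root.
- rewrite -[leLHS]root1; apply: ge0_ler_powR; rewrite ?nnegrE ?invr_ge0 ?(ltW p0)//.
  + by rewrite addr_ge0.
  + by rewrite lerDl.
- by rewrite root// addr_ge0.
Qed.

(** Pass through [(2 * k) ^ q]. The factor 2 trades the [k + 1] of the recursion for [k]. *)
Lemma powR_succ_le (R : realType) (q : R) (k : nat) : 0 < q <= 1 -> (0 < k)%N ->
  (k.+1)%:R `^ q <= 2 * k%:R `^ q :> R.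
Proof.
move=> /andP[q0 q1] k0; apply: (@le_trans _ _ ((2 * k%:R) `^ q)).
  apply: ge0_ler_powR; rewrite ?nnegrE ?(ltW q0)// ?mulr_ge0//.
  by rewrite -natrM ler_nat mul2n -addnn -addn1 leq_add2l.
rewrite powRM// ler_wpM2r ?powR_ge0// -[leRHS]powRr1//.
by rewrite ler_powR// ler1n.
Qed.

Theorem theorem2p2 (R : realType) (p : R) (Y : completeNormedModType R) :
  1 < p -> quasi_reflexive Y -> p_AUS Y p ->
  exists2 C : R, 0 < C &
    forall (k : nat) (M : set nat), infinite_set M ->
    forall f : Gk k M -> dual (dual Y), is_lipschitz f ->
    forall eps : R, 0 < eps ->
    exists M' : set nat, [/\ M' `<=` M, infinite_set M' &
      forall n m : Gk k M, Ik k M' (val n, val m) ->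
        `|f n - f m| <= C * Lip f * k%:R `^ p^-1 + eps].
Proof.
move=> p1 qrY [c c0 ausY].
have [u [K [u0 up K1 Kp]]] := smoothing_constants p1 (ltW c0).
have K0 : 0 < K by exact: lt_le_trans K1.
(* One factor 2 comes from [T], close to [2 * Lip f], the other from replacing [k + 1] by [k] under
   the root. *)
exists (4 * K); first by rewrite mulr_gt0.
move=> k M Minf f flip eps eps0; have Lip0 := Lip_ge0 flip.
(* For [k = 0] there is at most one point; [powR_succ_le] needs [0 < k]. *)
have [k0|k0] := posnP k.
  exists M; split => // n m _; have -> : n = m.
    apply/val_inj/val_inj; apply: (@eq_from_nth _ 0%N).
      by rewrite !size_tuple.
    by move=> i; rewrite size_tuple [X in (_ < X)%N]k0.
  by rewrite subrr normr0 addr_ge0 ?(ltW eps0)// !mulr_ge0 ?powR_ge0// ltW.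
pose kp := k%:R `^ p^-1 : R.
have kp0 : 0 < kp by rewrite powR_gt0// ltr0n.
(* [tau] keeps [T] positive even when [Lip f = 0]. It enters the final bound as
   [2 * K * kp * tau = eps / 2], and [eps2] supplies the other half. *)
pose tau := eps / (4 * K * kp).
have Kkp : 0 < 4 * K * kp by rewrite !mulr_gt0.
have tau0 : 0 < tau by rewrite divr_gt0.
have tauE : 4 * K * kp * tau = eps by rewrite mulrC divfK// gt_eqF.
have tau2 : 0 < tau / 2 by rewrite divr_gt0.
have [L fL Ltau] := Lip_adherent flip tau2.
pose T := 2 * Lip f + tau.
have T0 : 0 < T by rewrite /T; lra.
have LT : 2 * L < T by rewrite /T; lra.
have [U [UU U_M U_infty]] := exists_free_ultrafilter Minf.
have [C FC] := Gk_ext_bounded fL.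
have eps2 : 0 < eps / 2 by rewrite divr_gt0.
have bound := near2_norm_bound (UU := UU) p1 qrY (ltW c0) ausY u0 up K1 Kp U_M U_infty FC
  (fun s a b q => Gk_ext_lip fL) T0 LT (leqnn k) eps2.
have [M' [M'M M'inf HM']] := near2_extraction (UU := UU) U_M U_infty bound.
exists M'; split => // n m [/= [_ nM] [_ mM] lt1 lt2].
have nmM' : increasing_in M' (interleave (val n) (val m)).
  split=> [|a /mem_interleave[]/tnthP[i ->]//].
  apply: sorted_interleave; rewrite ?size_tuple// => i ik.
    by have := lt1 (Ordinal ik); rewrite !(tnth_nth 0%N).
  by have := lt2 (Ordinal (ltnW ik)) (Ordinal ik) erefl; rewrite !(tnth_nth 0%N).
have := HM' _ _ (size_tuple _) (size_tuple _) nmM'.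
(* With all [k] entries fixed no limit remains, and [iter_lim] is [f] itself. *)
rewrite subnn /= !Gk_extE => /ltW /le_trans; apply.
have q01 : 0 < p^-1 <= 1.
  by rewrite invr_gt0 (lt_trans ltr01 p1)/= invf_le1 ?ltW// (lt_trans ltr01).
have := powR_succ_le q01 k0; rewrite -/kp => kp2.
have KT : 0 < K * T by rewrite mulr_gt0.
have := ler_wpM2l (ltW KT) kp2; rewrite /T in KT *; lra.
Qed.
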